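(* Let $\Gamma$ be a canonical signed unicyclic graph of order $n$ whose unique cycle $C_g^\sigma$ has length $g$. (1) If $\Gamma=C_g^\sigma$ is a cycle, then $\eta(\Gamma)=n-g$ (i.e. $A(\Gamma)$ is nonsingular) if and only if $g$ is odd, or $C_g^\sigma$ is balanced and $g\equiv 2\pmod 4$, or $C_g^\sigma$ is unbalanced and $g\equiv 0\pmod 4$. (2) If $\Gamma$ is not a cycle, let $v_1,\dots,v_k$ ($k\ge1$) be the major vertices in cyclic order along $C_g^\sigma$ and let $l_1,\dots,l_k\ge0$ be the numbers of cycle vertices strictly between consecutive major vertices (indices mod $k$; for $k=1$, $l_1=g-1$). Then $\eta(\Gamma)=n-g$ if and only if $g$ is even and all of $l_1,\dots,l_k$ are odd.
   Context: A signed graph $\Gamma=(G,\sigma)$ is a simple graph $G$ with a sign function $\sigma:E(G)\to\{+,-\}$; its adjacency matrix has $(u,v)$-entry $\sigma(uv)$ if $uv\in E(G)$, $0$ otherwise, and $\eta(\Gamma)$ is the multiplicity of the eigenvalue $0$. A cycle is balanced if the product of its edge signs is $+$, unbalanced otherwise. A signed unicyclic graph is a connected signed graph with exactly one cycle. It is called canonical if, with $C$ its unique cycle, every vertex not on $C$ is adjacent to exactly one vertex of $C$ and the vertices not on $C$ are pairwise nonadjacent. A vertex of $C$ having at least one neighbour outside $C$ is called a major vertex. *)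

(* Defs.v *)
From HB Require Import structures.
From mathcomp Require Import all_boot all_order all_algebra.
Set Implicit Arguments. Unset Strict Implicit. Unset Printing Implicit Defensive.
Import Order.TTheory GRing.Theory Num.Theory.

(* A signed graph on vertex set 'I_n: a simple graph given by a symmetric,
   irreflexive adjacency relation [e], and a sign function [s] on edges,
   where [s x y = true] means the edge xy has sign '-'. *)
Definition signed_graph n (e : rel 'I_n) (s : 'I_n -> 'I_n -> bool) : Prop :=
  (forall x, ~~ e x x) /\ (forall x y, e x y = e y x) /\
  (forall x y, e x y -> s x y = s y x).

Definition sadj n (e : rel 'I_n) (s : 'I_n -> 'I_n -> bool) : 'M[rat]_n :=
  \matrix_(i, j) (if e i j then (if s i j then -1 else 1) else 0)%R.

Definition eta n (e : rel 'I_n) s : nat := mup 0%R (char_poly (sadj e s)).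

Definition is_gcycle n (e : rel 'I_n) (c : seq 'I_n) : Prop :=
  [/\ uniq c, 3 <= size c & cycle e c].

Definition cyc_edge n (c : seq 'I_n) (x y : 'I_n) : bool :=
  (x \in c) && (y \in c) && ((y == next c x) || (x == next c y)).

Definition connected n (e : rel 'I_n) : Prop := forall x y, connect e x y.

Definition unicyclic n (e : rel 'I_n) : Prop :=
  connected e /\
  exists c, is_gcycle e c /\
    forall c', is_gcycle e c' -> forall x y, cyc_edge c' x y = cyc_edge c x y.

Definition canonical n (e : rel 'I_n) (c : seq 'I_n) : Prop :=
  (forall x, x \notin c -> #|[set y in c | e x y]| = 1) /\
  (forall x y, x \notin c -> y \notin c -> ~~ e x y).

Definition balanced n (s : 'I_n -> 'I_n -> bool) (c : seq 'I_n) : bool :=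
  (\prod_(x <- c) (if s x (next c x) then (-1) else 1 : int) == 1)%R.

Definition major n (e : rel 'I_n) (c : seq 'I_n) (x : 'I_n) : bool :=
  (x \in c) && [exists y, e x y && (y \notin c)].

(* For a major vertex x, the number of cycle vertices strictly between x and
   the next major vertex in the cyclic order of c (equal to size c - 1 if x
   is the only major vertex). *)
Definition gap n (e : rel 'I_n) (c : seq 'I_n) (x : 'I_n) : nat :=
  find (major e c) (behead (rot (index x c) c)).

(* Main.v *)
(* The matrix A is symmetric, hence diagonalizable over the algebraic numbers,
   so the multiplicity of 0 is the dimension of the kernel. The cycle has no
   chord, so at a non-major cycle vertex w_(j+1) the kernel equation involves
   only w_j and w_(j+2); after multiplying x at w_j by the product r_j of the
   first j edge signs it reads z_j + z_(j+2) = 0.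

   If there is no pendant vertex, going around the cycle (twice when g is odd)
   gives z_(j+g) = r_g z_j and forces z = 0 except when g is even and
   r_g = (-1)^(g/2), in which case z = 1, 0, -1, 0, ... closes up.

   Otherwise the kernel vectors vanish at the major vertices. Choose one pendant
   vertex at each major vertex. A kernel vector is determined by its values at
   the n - g vertices that are either a non-chosen pendant vertex or the
   successor of a major vertex on the cycle: the recurrence restarts from zero
   at each major vertex v, and the equation at v gives the value at the chosen
   pendant vertex of v. So the nullity is at most n - g,
   with equality iff each of these values can be nonzero alone. This is always
   possible at the pendant vertices; at the successor of a major vertex v it is
   possible iff z = 1, 0, -1, ... vanishes at the next major vertex, that is, iff
   the gap after v is odd. Odd gaps everywhere make g = sum (l_i + 1) even. *)

Require Import Defs.
From mathcomp Require Import all_boot all_order all_algebra all_field.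
From mathcomp Require Import zify ring lra.
Set Implicit Arguments. Unset Strict Implicit. Unset Printing Implicit Defensive.
Import GRing.Theory Num.Theory.
Local Open Scope ring_scope.

(** * Nullity, and the multiplicity of the eigenvalue 0 of a symmetric matrix *)

(** Restriction to the coordinates in [F] embeds the kernel in [K^F]. The dimensions agree iff this
    map is onto, that is, iff its image contains a multiple of each basis vector. *)
Lemma nullity_coords (K : fieldType) n (A : 'M[K]_n) (F : {set 'I_n}) :
    (forall x : 'rV_n, x *m A = 0 -> {in F, forall i, x 0 i = 0} -> x = 0) ->
  (n - \rank A)%N = #|F| <->
  {in F, forall i, exists x : 'rV_n,
    [/\ x *m A = 0, x 0 i != 0 & {in F, forall j, j != i -> x 0 j = 0}]}.
Proof.
move=> inj; pose S : 'M[K]_(n, #|F|) := \matrix_(i, j) (i == enum_val j)%:R.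
have SE (x : 'rV_n) j : (x *m S) 0 j = x 0 (enum_val j).
  rewrite mxE (bigD1 (enum_val j)) //= mxE eqxx mulr1 big1 ?addr0 // => i ne_i.
  by rewrite mxE (negPf ne_i) mulr0.
have rkS : \rank (kermx A *m S) = (n - \rank A)%N.
  rewrite -mxrank_ker; apply/mxrank_injP/rowV0P => x.
  rewrite sub_capmx => /andP[/sub_kermxP xA /sub_kermxP xS]; apply: inj => // i Fi.
  have [j ->] : exists j : 'I_#|F|, i = enum_val j.
    by exists (enum_rank_in Fi i); rewrite enum_rankK_in.
  by rewrite -SE xS mxE.
have {}rkS : (n - \rank A)%N = #|F| <-> row_full (kermx A *m S).
  by rewrite -rkS /row_full; split=> /eqP.
apply: (iff_trans rkS); split=> [full i Fi | free].
  pose j := enum_rank_in Fi i; have Ej : enum_val j = i by rewrite enum_rankK_in.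
  have /submxP[u Eu] := submx_full (delta_mx 0 j : 'rV_#|F|) full.
  exists (u *m kermx A); have xE k : (u *m kermx A) 0 (enum_val k) = (k == j)%:R.
    by rewrite -SE -mulmxA -Eu mxE eqxx.
  split; first by rewrite -mulmxA mulmx_ker mulmx0.
    by rewrite -Ej xE eqxx oner_eq0.
  move=> k Fk; rewrite -(enum_rankK_in Fi Fk) xE => ne_ki.
  by rewrite -(inj_eq enum_val_inj) Ej (negPf ne_ki).
rewrite -sub1mx; apply/row_subP => j; rewrite row1.
have [x [xA xj x0]] := free _ (enum_valP j).
have -> : delta_mx 0 j = (x 0 (enum_val j))^-1 *: (x *m S).
  apply/rowP => k; rewrite mxE [in RHS]mxE SE eqxx /=.
  have [->|ne_kj] := eqVneq k j; first by rewrite mulVf.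
  have ne_v : enum_val k != enum_val j by rewrite (inj_eq enum_val_inj).
  by rewrite (x0 _ (enum_valP k) ne_v) mulr0.
by rewrite scalemx_sub // submxMr //; apply/sub_kermxP.
Qed.

Lemma mxrank_diag (K : fieldType) n (d : 'rV[K]_n) :
  (n - \rank (diag_mx d))%N = #|[set i | d 0 i == 0]|.
Proof.
have dE (x : 'rV_n) i : (x *m diag_mx d) 0 i = x 0 i * d 0 i.
  by rewrite mul_mx_diag mxE.
apply/nullity_coords => [x /rowP xd0 x0 | i].
  apply/rowP => i; rewrite mxE; have [/eqP di0|di_neq0] := boolP (d 0 i == 0).
    by rewrite x0 // inE di0.
  by apply: (mulIf di_neq0); rewrite mul0r -dE xd0 mxE.
rewrite inE => /eqP di0; exists (delta_mx 0 i); split.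
- apply/rowP => j; rewrite dE !mxE eqxx /=.
  by have [->|] := eqVneq j i; rewrite ?di0 ?mulr0 ?mul0r.
- by rewrite mxE !eqxx oner_neq0.
- by move=> j _ ne_ji; rewrite mxE (negPf ne_ji) andbF.
Qed.

Lemma char_poly_conj (R : comUnitRingType) n (P D : 'M[R]_n) :
  P \in unitmx -> char_poly (invmx P *m D *m P) = char_poly D.
Proof.
move=> uP; rewrite /char_poly.
have polyP : map_mx polyC (invmx P) *m map_mx polyC P = 1%:M.
  by rewrite -map_mxM mulVmx // map_mx1.
have -> : char_poly_mx (invmx P *m D *m P) =
    map_mx polyC (invmx P) *m char_poly_mx D *m map_mx polyC P.
  by rewrite /char_poly_mx mulmxBr mulmxBl !map_mxM scalar_mxC -(mulmxA 'X%:M) polyP mulmx1.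
by rewrite !det_mulmx mulrAC -det_mulmx polyP det1 mul1r.
Qed.

(** Over [algC] the matrix is normal, hence diagonalizable. Both sides survive field extension and
    conjugation, and for a diagonal matrix both count the zeros on the diagonal. *)
Lemma mup_char_poly_sym n (A : 'M[rat]_n) :
  A^T = A -> mup 0 (char_poly A) = (n - \rank A)%N.
Proof.
move=> symA; pose toC : {rmorphism rat -> algC} := ratr.
pose B := map_mx toC A.
have /orthomx_spectralP BE : B \is normalmx.
  apply/normalmxP; suff -> : map_mx Num.conj B^T = B by [].
  by apply/matrixP => i j; rewrite !mxE -{2}symA mxE /= fmorph_rat.
(* Powers of X map to powers of X, and divisibility is preserved and reflected by a field
   embedding. *)
have mupB : mup 0 (char_poly B) = mup 0 (char_poly A).
  have nz (R : nzRingType) (M : 'M[R]_n) := monic_neq0 (char_poly_monic M).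
  apply/eqP; rewrite eqn_leq mup_geq ?mup_leq ?nz // -map_char_poly.
  have XE k : ('X - 0%:P) ^+ k = map_poly toC (('X - 0%:P) ^+ k).
    by rewrite !subr0 map_polyXn.
  by rewrite -!(dvdp_map toC) -!XE map_char_poly -mup_geq -?mup_ltn ?nz ?leqnn.
rewrite -mupB -(mxrank_map toC) -/B BE char_poly_conj ?spectral_unit //.
rewrite char_poly_trig ?diag_mx_is_trig //.
rewrite mxrankMfree ?row_free_unit ?spectral_unit //.
rewrite eqmxMfull ?row_full_unit ?unitmx_inv ?spectral_unit // mxrank_diag.
rewrite -(big_map (fun i => diag_mx (spectral_diag B) i i) xpredT (fun y => 'X - y%:P)).
rewrite mu_prod_XsubC count_map cardsE cardE size_filter /index_enum -enumT.
by apply: eq_count => i; rewrite !inE /= mxE eqxx.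
Qed.

(** * Walks around a cycle and the absence of chords *)

Lemma iter_next (T : eqType) (c : seq T) (v : T) j : uniq c -> v \in c ->
  iter j (next c) v = nth v (rot (index v c) c) (j %% size c).
Proof.
move=> Uc cv; have c_gt0 : (0 < size c)%N by case: c cv {Uc}.
elim: j => [|j /= ->]; first by rewrite mod0n rot_index.
rewrite -(next_rot (index v c) Uc) next_nth mem_nth ?size_rot ?ltn_mod //.
rewrite index_uniq ?rot_uniq ?size_rot ?ltn_mod // modnS.
have := size_rot (index v c) c; rewrite rot_index //=.
set q := drop _ _ ++ _ => sz_q; case: ifP => //= dvd_j.
rewrite nth_default // -ltnS sz_q dvdn_leq //.
by move: dvd_j; rewrite {1}(divn_eq j (size c)) -addnS dvdn_addr // dvdn_mull.
Qed.

(** If y does not directly follow x, the arc of [c] from x to y closed by the edge xy is a cycle. By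
    uniqueness its edges, xy among them, are edges of [c]. *)
Lemma chordless n (e : rel 'I_n) (c : seq 'I_n) :
    unicyclic e -> is_gcycle e c ->
    (forall x, ~~ e x x) -> (forall x y, e x y = e y x) ->
  {in c &, forall x y, e x y -> cyc_edge c x y}.
Proof.
move=> [_ [c0 [_ c0P]]] gc irr sym x y cx cy exy.
have [Uc _ cyc_c] := gc; have [i d Ed] := rot_to cx.
have Ud : uniq (x :: d) by rewrite -Ed rot_uniq.
have cyc_d : cycle e (x :: d) by rewrite -Ed rot_cycle.
have : y \in x :: d by rewrite -Ed mem_rot.
rewrite inE => /orP[/eqP Exy | dy]; first by rewrite Exy (negPf (irr x)) in exy.
rewrite (c0P c gc); case/splitPr: d / dy Ed Ud cyc_d => [d1 d2] Ed Ud cyc_d.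
have [d1_0 | d1_neq0] := eqVneq d1 [::].
  rewrite -(c0P c gc) /cyc_edge cx cy /= -(next_rot i Uc) Ed d1_0 /=.
  by rewrite !eqxx.
have Ed' : x :: d1 ++ y :: d2 = (x :: rcons d1 y) ++ d2 by rewrite /= cat_rcons.
have Ud1 : uniq (x :: rcons d1 y).
  by move: Ud; rewrite Ed' cat_uniq => /andP[].
have next_y : next (x :: rcons d1 y) y = x.
  rewrite next_nth !inE mem_rcons inE eqxx orbT.
  have ne_xy : x != y by apply: contraTneq exy => ->.
  rewrite /= (negPf ne_xy); have -> : index y (rcons d1 y) = size d1.
    move: Ud1 => /= /andP[_]; rewrite rcons_uniq => /andP[/negPf d1y _].
    by rewrite -cats1 index_cat d1y /= eqxx addn0.
  by rewrite nth_default // size_rcons.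
rewrite -(c0P (x :: rcons d1 y)).
  by rewrite /cyc_edge next_y !inE !mem_rcons !inE !eqxx /= !orbT.
split=> //.
  by rewrite /= size_rcons !ltnS lt0n size_eq0.
move: cyc_d; rewrite /= rcons_cat cat_path => /andP[p_d1 /= /andP[e_y _]].
by rewrite rcons_path last_rcons sym exy andbT rcons_path p_d1.
Qed.

(** * The recurrence z_j + z_(j+2) = 0 *)

Lemma alternating_step (z : nat -> rat) j m :
    (forall i, (i < m)%N -> z (j + i.*2)%N + z (j + i.*2).+2 = 0) ->
  z (j + m.*2)%N = (-1) ^+ m * z j.
Proof.
elim: m => [|m IH] z0; first by rewrite addn0 mul1r.
rewrite doubleS !addnS exprS -mulrA -IH => [|i lt_im]; last first.
  by rewrite z0 // ltnW.
by rewrite mulN1r; apply/eqP; rewrite -addr_eq0 addrC z0.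
Qed.

(* Values of [z_j + z_(j+2) = 0] started at [z_0 = 1], [z_1 = 0]. *)
Definition alternating (j : nat) : rat := if odd j then 0 else (-1) ^+ j./2.

Lemma alternatingSS j : alternating j + alternating j.+2 = 0.
Proof.
by rewrite /alternating /= negbK; case: ifP; rewrite ?addr0 // exprS mulN1r subrr.
Qed.

Lemma alternating_double j m :
  alternating (j + m.*2) = (-1) ^+ m * alternating j.
Proof. by apply: alternating_step => i _; rewrite alternatingSS. Qed.

Lemma nullity_eq0 (K : fieldType) n (A : 'M[K]_n) :
  (n - \rank A = 0)%N <-> (forall x : 'rV_n, x *m A = 0 -> x = 0).
Proof.
rewrite -mxrank_ker; split=> [/eqP | inj].
  by rewrite mxrank_eq0 => /rowV0P ker0 x /sub_kermxP /ker0.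
by apply/eqP; rewrite mxrank_eq0; apply/rowV0P => x /sub_kermxP /inj.
Qed.

(** * Kernel equations along the signed cycle *)

Section Walk.
Variables (n : nat) (e : rel 'I_n) (s : 'I_n -> 'I_n -> bool) (c : seq 'I_n).
Hypothesis graph_es : signed_graph e s.
Hypothesis gcycle_c : is_gcycle e c.
Hypothesis chordless_c : {in c &, forall x y, e x y -> cyc_edge c x y}.

Local Notation A := (sadj e s).
Local Notation g := (size c).
Local Notation walk v j := (iter j (next c) v).

Let sym x y : e x y = e y x. Proof. by case: graph_es => _ []. Qed.
Let Uc : uniq c. Proof. by case: gcycle_c. Qed.
Let g_ge3 : (3 <= g)%N. Proof. by case: gcycle_c. Qed.
Let g_gt0 : (0 < g)%N. Proof. exact: ltn_trans g_ge3. Qed.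

Lemma sadj_sym x y : A x y = A y x.
Proof.
rewrite !mxE sym; case: ifP => // eyx.
by case: graph_es => _ [_ /(_ y x eyx) ->].
Qed.

Lemma sadj_eq0 x y : (A x y == 0) = ~~ e x y.
Proof. by rewrite mxE; case: (e x y) => //; case: (s x y). Qed.

Lemma sadj_sqr x y : e x y -> A x y * A x y = 1.
Proof. by rewrite mxE => ->; case: (s x y); rewrite ?mulrNN mulr1. Qed.

Lemma sadj_not_adj x y : ~~ e x y -> A x y = 0.
Proof. by rewrite -sadj_eq0 => /eqP. Qed.

Lemma mem_walk v j : (walk v j \in c) = (v \in c).
Proof. by elim: j => //= j; rewrite mem_next. Qed.

Lemma edge_next v : v \in c -> e v (next c v).
Proof. by apply: next_cycle; case: gcycle_c. Qed.

Lemma walk_period v j : v \in c -> walk v (j + g) = walk v j.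
Proof. by move=> cv; rewrite !iter_next // modnDr. Qed.

Lemma walk_onto v u : v \in c -> u \in c -> exists2 j, (j < g)%N & u = walk v j.
Proof.
move=> cv cu; exists (index u (rot (index v c) c)).
  by rewrite -(size_rot (index v c) c) index_mem mem_rot.
rewrite iter_next // modn_small ?nth_index ?mem_rot //.
by rewrite -(size_rot (index v c) c) index_mem mem_rot.
Qed.

Lemma walk_eq v i j : v \in c -> (walk v i == walk v j) = (i == j %[mod g]).
Proof.
move=> cv; rewrite !iter_next // nth_uniq ?rot_uniq ?size_rot ?ltn_mod //.
Qed.

Lemma next_inj : injective (next c).
Proof. exact: can_inj (prev_next Uc). Qed.

(** All neighbours of a non-major cycle vertex lie on the cycle, and without chords they are its
    predecessor and its successor. *)
Lemma not_major_row (y : 'rV[rat]_n) v :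
    v \in c -> ~~ major e c (next c v) ->
  (y *m A) 0 (next c v) =
    y 0 v * A v (next c v) +
    y 0 (next c (next c v)) * A (next c v) (next c (next c v)).
Proof.
move=> cv; rewrite /major mem_next cv /= => /existsPn notM.
(* The two neighbours are distinct because 0 and 2 differ modulo g >= 3. *)
have ne : v != next c (next c v).
  by rewrite (walk_eq 0 2 cv) !modn_small.
rewrite mxE (bigD1 v) //= (bigD1 (next c (next c v))) 1?eq_sym //= big1.
  by rewrite addr0 [A (next c (next c v)) _]sadj_sym.
move=> u /andP[ne_uv ne_u]; rewrite sadj_not_adj ?mulr0 //.
have := notM u; rewrite sym negb_and negbK => /orP[// | cu].
apply: contra ne_uv => /chordless_c; rewrite mem_next => /(_ cu cv).
rewrite /cyc_edge => /andP[_ /orP[/eqP/next_inj -> // | Eu]].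
by rewrite Eu in ne_u.
Qed.

(** The switching function that makes all edges of the walk positive. It depends on the number of
    steps, not on the vertex: a full turn multiplies it by the sign of the cycle. *)
Definition switch v j : rat := \prod_(i < j) A (walk v i) (walk v i.+1).

Lemma switchS v j : switch v j.+1 = switch v j * A (walk v j) (walk v j.+1).
Proof. exact: big_ord_recr. Qed.

Lemma switch_sqr v j : v \in c -> switch v j * switch v j = 1.
Proof.
move=> cv; elim: j => [|j IH]; first by rewrite /switch big_ord0 mulr1.
by rewrite switchS mulrACA IH mul1r sadj_sqr // edge_next // mem_walk.
Qed.

Lemma switch_neq0 v j : v \in c -> switch v j != 0.
Proof.
move=> cv; apply/eqP => r0; have /eqP := switch_sqr j cv.
by rewrite r0 mul0r eq_sym oner_eq0.
Qed.

Lemma switch_period v j : v \in c -> switch v (j + g) = switch v g * switch v j.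
Proof.
move=> cv; elim: j => [|j IH]; first by rewrite /switch big_ord0 mulr1.
by rewrite addSn !switchS IH -addSn !walk_period // mulrA.
Qed.

Lemma switch_cycle v : v \in c ->
  switch v g = (-1) ^+ (~~ balanced s c).
Proof.
move=> cv; pose b := (\prod_(x <- c) (if s x (next c x) then (-1) else 1 : int)).
have Eb : switch v g = b%:~R.
  rewrite /b rmorph_prod /= -(perm_big _ (permEl (perm_rot (index v c) c))) /=.
  rewrite (big_nth v) size_rot big_mkord; apply: eq_bigr => i _.
  have -> : nth v (rot (index v c) c) i = walk v i.
    by rewrite iter_next // modn_small.
  by rewrite mxE edge_next ?mem_walk //=; case: ifP.
have := switch_sqr g cv; rewrite Eb /balanced -/b -intrM => /(intr_inj (x2 := 1)) bb.
have : (b == 1) || (b == -1) by rewrite -sqrf_eq1 expr2 bb.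
by case/orP=> /eqP->.
Qed.

(** The sign of the incoming edge occurs twice and cancels; that of the outgoing edge is absorbed in
    the next [switch]. *)
Lemma switched_row (y : 'rV[rat]_n) v j :
    v \in c -> ~~ major e c (walk v j.+1) ->
  switch v j.+1 * (y *m A) 0 (walk v j.+1) =
    switch v j * y 0 (walk v j) + switch v j.+2 * y 0 (walk v j.+2).
Proof.
move=> cv notM; rewrite /= not_major_row ?mem_walk //.
rewrite (switchS v j.+1) (switchS v j) /=.
have := sadj_sqr (edge_next (etrans (mem_walk v j) cv)).
have := sadj_sqr (edge_next (etrans (mem_walk v j.+1) cv)) => /=.
set a := A _ _; set b := A _ _ => aa bb; rewrite mulrDr.
by congr (_ + _); [rewrite mulrCA -mulrA bb; ring | ring].
Qed.

(** Only the first g values of [f] are used; whether later steps of the walk agree with [f] is a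
    separate closing condition. *)
Definition cycle_vec v (f : nat -> rat) : 'rV[rat]_n :=
  \row_u (if u \in c then f (index u (rot (index v c) c)) else 0).

Lemma cycle_vecE v f j : v \in c -> cycle_vec v f 0 (walk v j) = f (j %% g)%N.
Proof.
move=> cv; rewrite mxE mem_walk cv iter_next // index_uniq ?rot_uniq //.
by rewrite size_rot ltn_mod.
Qed.

Lemma cycle_vec_out v f u : u \notin c -> cycle_vec v f 0 u = 0.
Proof. by rewrite mxE => /negPf ->. Qed.

(** * The cycle without pendant vertices *)

Lemma cycle_nullity : size c = n ->
  (n - \rank A = 0)%N <->
  [|| odd g, balanced s c && (g %% 4 == 2)%N | ~~ balanced s c && (g %% 4 == 0)%N].
Proof.
move=> gn; have all_c u : u \in c.
  have card_c : #|c| = #|'I_n| by rewrite card_ord (card_uniqP Uc).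
  by have /(subset_cardP card_c)-> : c \subset 'I_n by apply/subsetP.
have notM u : ~~ major e c u.
  by rewrite negb_and negb_exists; apply/orP; right; apply/forallP=> y; rewrite all_c andbF.
have [v cv] : exists v, v \in c by case: (c) g_gt0 => // v d _; exists v; rewrite mem_head.
(* For even g the last two cases say together that the sign of the cycle is not (-1)^(g/2). *)
have -> : [|| odd g, balanced s c && (g %% 4 == 2)%N | ~~ balanced s c && (g %% 4 == 0)%N]
    = odd g || (balanced s c == odd g./2).
  by case: (balanced s c) => /=; lia.
apply: (iff_trans (nullity_eq0 A)); split=> [inj | cond x xA0].
  apply: contraT; rewrite negb_or => /andP[even_g ne_bal].
  have rg : switch v g = (-1) ^+ g./2.
    rewrite (switch_cycle cv) -[RHS]signr_odd.
    by case: (balanced s c) ne_bal; case: (odd g./2).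
  (* Switching is undone on [alternating]. Over one turn both factors gain (-1)^(g/2), so the
     product closes up. *)
  pose f j := switch v j * alternating j.
  have alt_g j : alternating (j + g) = (-1) ^+ g./2 * alternating j.
    by rewrite -{1}(even_halfK even_g) alternating_double.
  have f_mod j : f (j %% g)%N = f j.
    rewrite [in RHS](divn_eq j g); elim: (j %/ g)%N => [|q IH]; first by rewrite add0n.
    rewrite mulSn -addnA addnC {1}IH {2}/f switch_period // rg alt_g.
    by rewrite mulrACA -exprD addnn -mul2n exprM sqrrN !expr1n mul1r.
  pose x := cycle_vec v f.
  have xE j : x 0 (walk v j) = f j by rewrite cycle_vecE // f_mod.
  have /inj/rowP/(_ v)/eqP : x *m A = 0.
    apply/rowP => u; have [j _ ->] := walk_onto cv (all_c u).
    (* One more turn writes the position as a successor, as [switched_row] requires. *)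
    rewrite -walk_period // -(prednK g_gt0) addnS.
    apply: (mulfI (switch_neq0 (j + g.-1).+1 cv)).
    rewrite [in RHS]mxE mulr0 switched_row // !xE /f !mulrA !switch_sqr // !mul1r.
    exact: alternatingSS.
  by rewrite -[v]/(walk v 0) xE /f /switch big_ord0 mul1r mxE oner_eq0.
pose z j := switch v j * x 0 (walk v j).
have zSS j : z j + z j.+2 = 0 by rewrite /z -switched_row // xA0 mxE mulr0.
have z_period j : z (j + g)%N = switch v g * z j.
  by rewrite /z switch_period // walk_period // mulrA.
have z_alt j m : z (j + m.*2)%N = (-1) ^+ m * z j by apply: alternating_step.
suff z0 j : z j = 0.
  apply/rowP => u; have [j _ ->] := walk_onto cv (all_c u).
  by apply: (mulfI (switch_neq0 j cv)); rewrite [in RHS]mxE mulr0 -[LHS]/(z j) z0.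
have [odd_g | even_g] := boolP (odd g).
  (* Two turns cancel the sign of the cycle, while g double steps give -1; hence z_j = - z_j. *)
  have := z_alt j g; rewrite -addnn addnA !z_period mulrA switch_sqr //.
  by rewrite -signr_odd odd_g; lra.
move: cond; rewrite (negPf even_g) /= => /eqP bal.
(* One turn multiplies z_j by the sign of the cycle and also by its opposite. *)
have := z_alt j g./2; rewrite even_halfK // z_period (switch_cycle cv) bal.
by rewrite -(signr_odd _ g./2); case: (odd _); rewrite /= ?expr1 ?expr0; lra.
Qed.

(** * Major vertices, gaps and pendant vertices *)

Hypothesis canonical_c : canonical e c.

Lemma major_in v : major e c v -> v \in c.
Proof. by case/andP. Qed.

Lemma gapP v : major e c v ->
  [/\ (gap e c v < g)%N, major e c (walk v (gap e c v).+1) &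
      forall j, (0 < j <= gap e c v)%N -> ~~ major e c (walk v j)].
Proof.
move=> Mv; have cv := major_in Mv.
have [q Eq] : exists q, rot (index v c) c = v :: q.
  by rewrite rot_index //; eexists.
have sz_q : (size q).+1 = g by rewrite -(size_rot (index v c) c) Eq.
have -> : gap e c v = find (major e c) q by rewrite /gap Eq.
have nth_q i : (i < size q)%N -> nth v q i = walk v i.+1.
  by move=> lt_i; rewrite iter_next // modn_small ?Eq // -sz_q.
split; first by rewrite -sz_q ltnS find_size.
  have [has_q | /hasNfind->] := boolP (has (major e c) q).
    by rewrite -nth_q -?has_find // nth_find.
  (* With no other major vertex [find] returns the length g - 1, and step g leads back to v. *)
  by rewrite sz_q -[g]add0n walk_period.
case=> // j /andP[_ lt_j]; rewrite -nth_q ?(leq_trans lt_j) ?find_size //.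
by rewrite before_find.
Qed.

Lemma attach_uniq x u w :
  x \notin c -> u \in c -> w \in c -> e x u -> e x w -> u = w.
Proof.
move=> cx cu cw exu exw; have [/(_ x cx)/eqP/cards1P[z Ez] _] := canonical_c.
have : u \in [set y in c | e x y] by rewrite inE cu.
have : w \in [set y in c | e x y] by rewrite inE cw.
by rewrite Ez !inE => /eqP-> /eqP.
Qed.

Lemma attach_ex x : x \notin c -> exists2 v, major e c v & e x v.
Proof.
move=> cx; have [/(_ x cx)/eqP/cards1P[v Ev] _] := canonical_c.
have : v \in [set y in c | e x y] by rewrite Ev inE.
rewrite inE => /andP[cv exv]; exists v => //.
by rewrite /major cv; apply/existsP; exists x; rewrite sym exv.
Qed.

Lemma major_ex : (g < n)%N -> exists v, major e c v.
Proof.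
move=> lt_gn; have [p cp] : exists p, p \notin c.
  apply/existsP; rewrite -negb_forall; apply: contraL lt_gn => /forallP all_c.
  rewrite -leqNgt -{1}(card_ord n) -(card_uniqP Uc); apply: subset_leq_card.
  exact/subsetP.
by have [v Mv _] := attach_ex cp; exists v.
Qed.

(** The default v only stands in where v has no neighbour outside the cycle. *)
Definition pendant v := odflt v [pick y | e v y && (y \notin c)].

Lemma pendantP v : major e c v -> e v (pendant v) /\ pendant v \notin c.
Proof.
rewrite /pendant => /andP[_ /existsP[y Py]].
by case: pickP => [z /andP[] | /(_ y)] //; rewrite Py.
Qed.

Lemma pendant_inj : {in major e c &, injective pendant}.
Proof.
move=> u w Mu Mw Euw; have [eu cu] := pendantP Mu; have [ew _] := pendantP Mw.
by apply: (attach_uniq cu); rewrite ?major_in // sym // Euw.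
Qed.

Lemma outside_row (y : 'rV[rat]_n) v p :
  p \notin c -> v \in c -> e p v -> (y *m A) 0 p = y 0 v * A v p.
Proof.
move=> cp cv epv; rewrite mxE (bigD1 v) //= big1 ?addr0 // => u ne_uv.
rewrite sadj_not_adj ?mulr0 // sym.
have [cu | cu] := boolP (u \in c).
  by apply: contra ne_uv => epu; apply/eqP/(attach_uniq cp).
by case: canonical_c => _ ->.
Qed.

(** The kernel equation at a pendant vertex attached to v involves v alone. *)
Lemma ker_major (x : 'rV[rat]_n) v : x *m A = 0 -> major e c v -> x 0 v = 0.
Proof.
move=> xA0 Mv; have [ev cp] := pendantP Mv; have cv := major_in Mv.
apply: (mulIf (x := A v (pendant v))); first by rewrite sadj_eq0 negbK.
by rewrite -outside_row // 1?sym // xA0 mxE mul0r.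
Qed.

(** * The coordinates that determine a kernel vector *)

Definition majors : {set 'I_n} := [set v | major e c v].
Definition chosen : {set 'I_n} := pendant @: majors.

(* The n - g coordinates that determine a kernel vector. *)
Definition free_coords : {set 'I_n} :=
  (~: [set u in c] :\: chosen) :|: next c @: majors.

Lemma chosen_out p : p \in chosen -> p \notin c.
Proof. by case/imsetP=> v; rewrite inE => /pendantP[_ cp] ->. Qed.

(** Each major vertex removes one pendant vertex and contributes one cycle vertex, its successor. *)
Lemma card_free_coords : #|free_coords| = (n - g)%N.
Proof.
have sub_ch : chosen \subset ~: [set u in c].
  by apply/subsetP => p /chosen_out; rewrite !inE.
have card_out : #|~: [set u in c]| = (n - g)%N.
  by rewrite cardsCs setCK card_ord cardsE (card_uniqP Uc).
have card_ch : #|chosen| = #|majors|.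
  by apply: card_in_imset => u w; rewrite !inE; apply: pendant_inj.
have le_ch := subset_leq_card sub_ch.
rewrite cardsU cardsD (setIidPr sub_ch) card_out (card_imset _ next_inj).
rewrite (_ : _ :&: _ = set0) ?cards0 ?subn0.
  by rewrite card_ch subnK // -card_ch -card_out.
apply/setP => u; rewrite !inE; apply/negP => /andP[/andP[_ cu] /imsetP[v]].
by rewrite inE => /major_in cv Eu; rewrite Eu mem_next cv in cu.
Qed.

Lemma free_not_chosen i : i \in free_coords -> i \notin chosen.
Proof.
rewrite !inE => /orP[/andP[] // | /imsetP[v]]; rewrite inE => /major_in cv ->.
by apply: (contraL (@chosen_out _)); rewrite mem_next.
Qed.

Lemma free_next v : major e c v -> next c v \in free_coords.
Proof. by move=> Mv; rewrite inE imset_f ?orbT // inE. Qed.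

Lemma free_coords_force (x : 'rV[rat]_n) : (g < n)%N ->
  x *m A = 0 -> {in free_coords, forall i, x 0 i = 0} -> x = 0.
Proof.
move=> lt_gn xA0 xF.
have [v Mv] := major_ex lt_gn.
have cv := major_in Mv.
(* Two consecutive zeros propagate: after a major vertex the next value is a free coordinate,
   elsewhere the recurrence gives it. *)
have walk0 j : x 0 (walk v j) = 0 /\ x 0 (walk v j.+1) = 0.
  elim: j => [|j [x0 x1]]; first by rewrite (ker_major xA0 Mv) xF ?free_next.
  split=> //; have [Mj | notM] := boolP (major e c (walk v j.+1)).
    by rewrite [walk v j.+2]/= xF ?free_next.
  have := switched_row x cv notM; rewrite xA0 mxE x0 !mulr0 add0r => /esym/eqP.
  by rewrite mulf_eq0 (negPf (switch_neq0 _ cv)) => /eqP.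
have xc u : u \in c -> x 0 u = 0.
  by move=> cu; have [j _ ->] := walk_onto cv cu; case: (walk0 j).
apply/rowP => p; rewrite mxE.
have [cp | cp] := boolP (p \in c); first exact: xc.
have [| not_chosen] := boolP (p \in chosen); last by rewrite xF // !inE not_chosen cp.
case/imsetP => w; rewrite inE => Mw ->; have [ew _] := pendantP Mw.
(* In the equation at w only the chosen pendant vertex of w is left: cycle and free values are zero,
   and other chosen vertices are not adjacent to w. *)
have : (x *m A) 0 w = 0 by rewrite xA0 mxE.
rewrite mxE (bigD1 (pendant w)) //= big1 => [|u ne_u].
  by rewrite addr0 => /eqP; rewrite mulf_eq0 sadj_eq0 sym ew orbF => /eqP.
have [cu | cu] := boolP (u \in c); first by rewrite xc ?mul0r.
have [| not_ch] := boolP (u \in chosen); last by rewrite xF ?mul0r // !inE not_ch cu.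
case/imsetP => z; rewrite inE => Mz Eu; rewrite sadj_not_adj ?mulr0 //.
have [ez cz] := pendantP Mz; rewrite Eu; apply: contra ne_u => ezw.
rewrite Eu; apply/eqP; congr pendant.
by apply: (attach_uniq cz); rewrite ?major_in // sym.
Qed.

(** * Construction of kernel vectors, and the parity of the gaps *)

(** The value at a chosen pendant vertex enters only the equation at its major vertex, so it can be
    adjusted to repair that equation. *)
Lemma ker_extension (y : 'rV[rat]_n) :
    (forall v, major e c v -> y 0 v = 0) ->
    (forall u, u \in c -> ~~ major e c u -> (y *m A) 0 u = 0) ->
  exists2 x : 'rV_n, x *m A = 0 & forall i, i \notin chosen -> x 0 i = y 0 i.
Proof.
move=> yM yA.
(* The sign [A v (pendant v)] is its own inverse, so multiplying by it solves the equation at v. *)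
pose x := y - \sum_(v in majors)
  ((y *m A) 0 v * A v (pendant v)) *: delta_mx 0 (pendant v).
have xE i : i \notin chosen -> x 0 i = y 0 i.
  move=> chi; rewrite !mxE summxE big1 ?subr0 // => v Mv.
  rewrite !mxE (negPf (_ : i != pendant v)) ?andbF ?mulr0 //.
  by apply: contraNneq chi => ->; apply: imset_f.
exists x => //; apply/rowP => w; rewrite [RHS]mxE.
have [cw | cw] := boolP (w \in c); last first.
  have [v Mv ewv] := attach_ex cw; rewrite (outside_row _ cw _ ewv) ?major_in //.
  by rewrite xE ?yM ?mul0r // (contraL (@chosen_out v)) // major_in.
rewrite mulmxBl mulmx_suml mxE [X in _ + X]mxE summxE.
have pend_row v :
    ((y *m A) 0 v * A v (pendant v) *: (delta_mx 0 (pendant v) : 'rV_n) *m A) 0 w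
    = (y *m A) 0 v * A v (pendant v) * A (pendant v) w.
  by rewrite -scalemxAl -rowE mxE [X in _ * X]mxE.
rewrite (eq_bigr _ (fun v _ => pend_row v)).
have off v : v \in majors -> v != w -> A (pendant v) w = 0.
  rewrite inE => Mv; have [ev cp] := pendantP Mv => ne_vw.
  apply: sadj_not_adj; apply: contra ne_vw => ew; apply/eqP.
  by rewrite sym in ev; apply: (attach_uniq cp (major_in Mv) cw ev ew).
have [Mw | notM] := boolP (w \in majors).
  rewrite (bigD1 w) //= big1 => [|v /andP[Mv /(off v Mv)->]]; last by rewrite mulr0.
  move: Mw; rewrite inE => /pendantP[ew _].
  by rewrite (sadj_sym (pendant w)) -mulrA sadj_sqr // mulr1 addr0 subrr.
rewrite big1 ?subr0 => [|v Mv]; first by apply: yA; rewrite ?inE in notM *.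
by rewrite off ?mulr0 //; apply: contraNneq notM => <-.
Qed.

Lemma odd_gaps_even_cycle :
    (forall x, major e c x -> odd (gap e c x)) ->
  (exists v, major e c v) -> ~~ odd g.
Proof.
move=> odd_gap [v Mv].
(* Generalized from a full turn to any walk between major vertices, so that the induction can split
   off one gap at a time. *)
suff even_major m u : major e c u -> major e c (walk u m) -> ~~ odd m.
  by apply: (even_major _ v Mv); rewrite -[g]add0n walk_period ?major_in.
elim/ltn_ind: m u => -[//|m] IH u Mu Mm.
have [_ Mnext notM] := gapP Mu; have odd_u := odd_gap u Mu.
have lt_gap : (gap e c u < m.+1)%N.
  by rewrite ltnNge; apply: contraL Mm => le_m; apply: notM.
have Em : (m.+1 = (m - gap e c u) + (gap e c u).+1)%N by lia.
have := IH (m - gap e c u)%N _ _ Mnext; rewrite -iterD -Em => /(_ _ Mm).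
by lia.
Qed.

(** For even l, positions 1 and l + 1 are joined by double steps, which carry the zero at the next
    major vertex back to position 1. *)
Lemma ker_even_gap (x : 'rV[rat]_n) v :
  x *m A = 0 -> major e c v -> ~~ odd (gap e c v) -> x 0 (next c v) = 0.
Proof.
move=> xA0 Mv even_l; have cv := major_in Mv; have [_ Mnext notM] := gapP Mv.
pose z j := switch v j * x 0 (walk v j).
have z_end : z (gap e c v).+1 = 0 by rewrite /z (ker_major xA0 Mnext) mulr0.
have : z (1 + (gap e c v)./2.*2)%N = (-1) ^+ (gap e c v)./2 * z 1%N.
  apply: alternating_step => i lt_i; rewrite add1n /z -switched_row //.
    by rewrite xA0 mxE mulr0.
  by apply: notM; lia.
rewrite even_halfK // add1n z_end => /esym/eqP.
rewrite mulf_eq0 signr_eq0 mulf_eq0 (negPf (switch_neq0 _ cv)).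
by move/eqP.
Qed.

Lemma ker_odd_gap v : major e c v -> odd (gap e c v) ->
  exists x : 'rV[rat]_n, [/\ x *m A = 0, x 0 (next c v) != 0 &
    {in free_coords, forall j, j != next c v -> x 0 j = 0}].
Proof.
move=> Mv odd_l; have cv := major_in Mv; have [lt_l Mnext notM] := gapP Mv.
set l := gap e c v in odd_l lt_l Mnext notM.
(* The shift puts zeros at even positions, among them 0 and, as l is odd, l + 1; cutting off after l
   then keeps the recurrence at every non-major vertex. *)
pose f j := if (j <= l)%N then alternating j.+1 else 0.
pose y := cycle_vec v (fun j => switch v j * f j).
have f_even j : ~~ odd j -> f j = 0.
  by rewrite /f /alternating /= => ->; rewrite if_same.
have f_l j : (l < j)%N -> f j = 0 by rewrite /f ltnNge; case: ifP.
(* The range includes j = g, where the walk is back at v and both sides vanish. *)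
have yE j : (j <= g)%N -> y 0 (walk v j) = switch v j * f j.
  rewrite cycle_vecE // leq_eqVlt => /orP[/eqP-> | lt_j]; last by rewrite modn_small.
  by rewrite modnn f_even // f_l // !mulr0.
have index_major u : major e c u -> exists j, [/\ (j < g)%N, u = walk v j & (j = 0 \/ l < j)%N].
  move=> Mu; have [j lt_j Eu] := walk_onto cv (major_in Mu); exists j; split=> //.
  case: j Eu {lt_j} => [|j] Eu; [by left | right].
  by rewrite ltnNge; apply: contraL Mu => le_j; rewrite Eu; apply: notM.
have yM u : major e c u -> y 0 u = 0.
  case/index_major => j [/ltnW le_j -> j0_lj]; rewrite (yE _ le_j).
  by case: j0_lj => [-> | lt_lj]; [rewrite f_even | rewrite f_l]; rewrite ?mulr0.
have yA u : u \in c -> ~~ major e c u -> (y *m A) 0 u = 0.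
  move=> cu; have [[|j] lt_j ->] := walk_onto cv cu; first by rewrite Mv.
  move=> nM; apply: (mulfI (switch_neq0 j.+1 cv)).
  rewrite mulr0 switched_row // !yE ?(ltnW (ltnW lt_j)) // !mulrA !switch_sqr // !mul1r.
  have ne_jl : j != l by apply: contraNneq nM => ->.
  have [lt_jl | gt_jl | Ejl] := ltngtP j l; last by rewrite Ejl eqxx in ne_jl.
    have [odd_j | even_j] := boolP (odd j); last by rewrite !f_even //= ?negbK ?addr0.
    rewrite /f ltnW // (_ : (j.+2 <= l)%N) ?alternatingSS //.
    by lia.
  by rewrite !f_l ?addr0 //; lia.
have [x xA0 xE] := ker_extension yM yA.
have xF i : i \in free_coords -> x 0 i = y 0 i by move/free_not_chosen/xE.
exists x; split=> //.
  rewrite xF ?free_next // -[next c v]/(walk v 1) yE //.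
  rewrite mulf_neq0 ?switch_neq0 // /f.
  by rewrite (_ : (1 <= l)%N) /alternating //=; lia.
move=> i Fi ne_i; rewrite xF //; move: Fi ne_i; rewrite !inE => /orP[/andP[_ ci] _ | ].
  by rewrite cycle_vec_out.
case/imsetP => u; rewrite inE => /index_major[j [lt_j -> [-> | lt_lj]]] ->.
  by rewrite eqxx.
by rewrite -[next c _]/(walk v j.+1) yE // f_l ?mulr0 // ltnW.
Qed.

(** The basis vector at p violates only the equation at the major vertex of p, which [ker_extension]
    repairs. *)
Lemma ker_free_pendant p : p \notin c -> p \notin chosen ->
  exists x : 'rV[rat]_n, [/\ x *m A = 0, x 0 p != 0 &
    {in free_coords, forall j, j != p -> x 0 j = 0}].
Proof.
move=> cp chp; pose y : 'rV[rat]_n := delta_mx 0 p.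
have yA u : u \in c -> ~~ major e c u -> (y *m A) 0 u = 0.
  move=> cu nM; rewrite -rowE [LHS]mxE sadj_not_adj //.
  apply: contra nM => epu; rewrite /major cu; apply/existsP.
  by exists p; rewrite sym epu.
have yM v : major e c v -> y 0 v = 0.
  move=> /major_in cv; rewrite mxE (negPf (_ : v != p)) ?andbF //.
  by apply: contraNneq cp => <-.
have [x xA0 xE] := ker_extension yM yA.
exists x; split=> //; first by rewrite xE // mxE !eqxx oner_eq0.
move=> j /free_not_chosen Fj ne_jp.
by rewrite xE // mxE (negPf ne_jp) andbF.
Qed.

Lemma canonical_nullity : (g < n)%N ->
  (n - \rank A = n - g)%N <->
  ~~ odd g /\ (forall x, major e c x -> odd (gap e c x)).
Proof.
move=> lt_gn; rewrite -card_free_coords.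
apply: (iff_trans (nullity_coords (fun x => @free_coords_force x lt_gn))).
split=> [free | [_ odd_gap] i].
  suff odd_gap v : major e c v -> odd (gap e c v).
    by split=> //; apply: odd_gaps_even_cycle (major_ex lt_gn).
  move=> Mv; have [x [xA0 x_neq0 _]] := free _ (free_next Mv).
  by apply: contraNT x_neq0 => even_l; rewrite ker_even_gap.
rewrite inE => /orP[| /imsetP[v]].
  by rewrite !inE => /andP[chi ci]; apply: ker_free_pendant.
by rewrite inE => Mv ->; apply: ker_odd_gap => //; apply: odd_gap.
Qed.

End Walk.

Local Close Scope ring_scope.

Theorem theorem5p2 (n : nat) (e : rel 'I_n) (s : 'I_n -> 'I_n -> bool)
    (c : seq 'I_n) :
  signed_graph e s -> unicyclic e -> is_gcycle e c -> canonical e c ->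
  (size c = n ->
     (eta e s = n - size c <->
      [|| odd (size c),
          balanced s c && (size c %% 4 == 2)
        | ~~ balanced s c && (size c %% 4 == 0)])) /\
  (size c < n ->
     (eta e s = n - size c <->
      ~~ odd (size c) /\ (forall x, major e c x -> odd (gap e c x)))).
Proof.
move=> graph_es uni gcyc can; have [irr [sym _]] := graph_es.
have chl := chordless uni gcyc irr sym.
have -> : eta e s = (n - \rank (sadj e s))%N.
  by apply: mup_char_poly_sym; apply/matrixP => i j; rewrite mxE sadj_sym.
split=> [gn | lt_gn]; last exact: canonical_nullity.
have -> : n - size c = 0 by rewrite gn subnn.
exact: cycle_nullity.
Qed.
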